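(* For all positive integers $n$ and $k$ with $n \geq 2k \geq 4$, $$\chi_s(\mathrm{KG}(n,k)) \geq \max\{2\chi(\mathrm{KG}(n,k)) - 10,\ \chi(\mathrm{KG}(n,k))\}.$$
   Context: For $n \geq 2k$, the Kneser graph $\mathrm{KG}(n,k)$ is the graph whose vertices are the $k$-element subsets of $[n]=\{1,\ldots,n\}$, two vertices $A,B$ being adjacent iff $A\cap B=\emptyset$; its chromatic number is $\chi(\mathrm{KG}(n,k)) = n-2k+2$. A star-free coloring of a graph $G$ is a proper coloring $c: V(G)\to\mathbb{N}$ such that no path on three vertices is colored with just two consecutive integers. The star-free chromatic number $\chi_s(G)$ is the minimum positive integer $t$ such that there is a star-free coloring $c: V(G)\to\{1,\ldots,t\}$. *)

(* Defs.v *)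
From mathcomp Require Import all_boot.
From mathcomp Require Import boolp.

Set Implicit Arguments.
Unset Strict Implicit.
Unset Printing Implicit Defensive.

Record sgraph := SGraph {
  vertex :> finType;
  adj : rel vertex;
  adj_sym : symmetric adj;
  adj_irrefl : irreflexive adj }.

Section Colorings.
Variable G : sgraph.

Definition proper_coloring (c : G -> nat) : Prop :=
  forall x y : G, adj x y -> c x <> c y.

Definition path3 (x y z : G) : bool := [&& x != z, adj x y & adj y z].

Definition star_free_coloring (c : G -> nat) : Prop :=
  proper_coloring c /\
  forall x y z : G, path3 x y z ->
    ~ exists i : nat, forall v : G, v \in [:: x; y; z] -> c v = i \/ c v = i.+1.

Definition colorable (t : nat) : Prop :=
  exists c : G -> nat, proper_coloring c /\ forall v, 1 <= c v <= t.

Definition star_free_colorable (t : nat) : Prop :=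
  exists c : G -> nat, star_free_coloring c /\ forall v, 1 <= c v <= t.

Lemma star_free_colorable_card : star_free_colorable #|G|.+1.
Proof.
pose c (v : G) := (enum_rank v).+1.
have c_inj : injective c by move=> u v [] /ord_inj /enum_rank_inj.
exists c; split; last by move=> v; rewrite /c /= ltnS ltnW.
split=> [x y xy /c_inj eq_xy|x y z /and3P[xz xy yz] [i ci]].
  by rewrite eq_xy adj_irrefl in xy.
have nxy : c x <> c y by move=> /c_inj e; rewrite e adj_irrefl in xy.
have nyz : c y <> c z by move=> /c_inj e; rewrite e adj_irrefl in yz.
have nxz : c x <> c z by move=> /c_inj e; rewrite e eqxx in xz.
have := ci x; have := ci y; have := ci z.
rewrite !inE !eqxx !orbT => /(_ isT) hz /(_ isT) hy /(_ isT) hx.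
by case: hx; case: hy; case: hz; congruence.
Qed.

Lemma colorable_ex : exists t, `[< colorable t >].
Proof.
have [c [[c_proper _] c_le]] := star_free_colorable_card.
by exists #|G|.+1; apply/asboolP; exists c.
Qed.

Lemma star_free_colorable_ex :
  exists t, `[< 0 < t /\ star_free_colorable t >].
Proof.
by exists #|G|.+1; apply/asboolP; split=> //; exact: star_free_colorable_card.
Qed.

Definition chromatic_number : nat := ex_minn colorable_ex.

Definition star_free_chromatic_number : nat := ex_minn star_free_colorable_ex.

End Colorings.

Section Kneser.
Variables n k : nat.

Definition kneser_vertex : finType := {A : {set 'I_n} | #|A| == k}.

(* The conjunct A != B is implied by disjointness when k > 0; it only serves to
   exclude the loop at the empty set when k = 0. *)
Definition kneser_adj : rel kneser_vertex :=
  fun A B => (A != B) && [disjoint val A & val B].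

Lemma kneser_adj_sym : symmetric kneser_adj.
Proof. by move=> A B; rewrite /kneser_adj eq_sym disjoint_sym. Qed.

Lemma kneser_adj_irrefl : irreflexive kneser_adj.
Proof. by move=> A; rewrite /kneser_adj eqxx. Qed.

Definition kneser : sgraph := SGraph kneser_adj_sym kneser_adj_irrefl.

End Kneser.

(* Main.v *)
(** Write t = n - 2k; since chi(KG(n,k)) <= t + 2, it suffices that a star-free
    colouring with colours 1..m satisfies m >= 2t.  Pair the colours into
    classes {2i, 2i+1}: by star-freeness each class induces a matching.  Label a
    sign vector x = (X, Y), i.e. two disjoint subsets of [n], by the set V(x) of
    all signed classes: +i if X contains a k-set of class i, and -i if Y does.
    Label sets are simplices of a cross-polytope on about m/2 axes.  If V(x)
    is nonempty, then either some label of V(x) occurs with one sign only, and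
    the full subcomplex on V(x) is a cone; or every class present in x occurs
    exactly once in X and once in Y, so that C(|X|,k) = C(|Y|,k) classes
    occur and the subcomplex is a sphere of dimension C(|X|,k) - 1.  Since
    C(s,k) >= 2s - 2k + 1 for s >= k >= 2, V is therefore (up to 2k - 1
    padding axes) an equivariant acyclic carrier from the boundary of the
    n-dimensional cross-polytope.  It carries an equivariant chain map over
    F_2, and a Borsuk-Ulam argument on hemispheres gives
    n <= (2k - 1) + (m/2 + 1). *)

Require Import Defs.
From mathcomp Require Import all_boot all_order all_algebra.
From mathcomp Require Import boolp zify.
Import Order.TTheory GRing.Theory Num.Theory.

Set Implicit Arguments.
Unset Strict Implicit.
Unset Printing Implicit Defensive.

Local Open Scope ring_scope.

(** * Chains mod 2 on sets of signed labels *)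

Lemma F2_addxx (a : 'F_2) : a + a = 0.
Proof. by rewrite addrr_pchar2 // pchar_Fp. Qed.

Lemma addF2 (V : finType) (c : {ffun V -> 'F_2}) : c + c = 0.
Proof. by apply/ffunP => S; rewrite !ffunE F2_addxx. Qed.

(** Each orbit of [s] has two elements with equal terms, and these cancel in characteristic 2. *)
Lemma sum_involution (U : finType) (M : zmodType) (P : pred U) (s : U -> U)
    (F : U -> M) :
  (forall a : M, a + a = 0) ->
  (forall u, P u -> [/\ P (s u), s (s u) = u, s u != u & F (s u) = F u]) ->
  \sum_(u | P u) F u = 0.
Proof.
move=> char2 sP.
pose lo u := (enum_rank u < enum_rank (s u))%N.
rewrite (bigID lo) /= [X in _ + X](reindex_onto s s) /=; last first.
  by move=> u /andP[/sP[]].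
rewrite [X in _ + X](eq_big (fun u => P u && lo u) F) ?char2 //; last first.
  by move=> u /andP[/andP[Psu _] /eqP ssu]; have [_ _ _] := sP _ Psu; rewrite ssu.
move=> u; apply/andP/andP => [[/andP[Psu lou] /eqP ssu]|[Pu]].
  have [Pu _ ne _] := sP _ Psu; rewrite ssu in Pu ne; split=> //.
  move: lou; rewrite /lo ssu -leqNgt leq_eqVlt.
  by rewrite (inj_eq val_inj) (inj_eq enum_rank_inj) (negPf ne).
have [-> E _ _] := sP _ Pu; rewrite /lo E eqxx -leqNgt => lou.
by rewrite ltnW.
Qed.

Section Chains.
Variable T : finType.
Implicit Types (S V : {set T * bool}) (v : T * bool).

Definition chain := {ffun {set T * bool} -> 'F_2}.
Implicit Type c : chain.

Definition flip v := (v.1, ~~ v.2).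
Definition neg S : {set T * bool} := flip @^-1: S.
(** Consistent sets are the simplices of the boundary of the cross-polytope on the axes [T], with
    [neg] as antipodal map; over ['I_n] they are the sign vectors. *)
Definition consistent S := [forall v in S, flip v \notin S].

Lemma flipK : involutive flip.
Proof. by case=> i b; rewrite /flip /= negbK. Qed.

Lemma flip_neq v : flip v != v.
Proof. by case: v => i b; rewrite xpair_eqE eqxx; case: b. Qed.

Lemma in_neg v S : (v \in neg S) = (flip v \in S).
Proof. by rewrite inE. Qed.

Lemma negK : involutive neg.
Proof. by move=> S; apply/setP => v; rewrite !in_neg flipK. Qed.

Lemma neg_setU1 v S : neg (v |: S) = flip v |: neg S.
Proof. by apply/setP => u; rewrite !inE (can2_eq flipK flipK). Qed.

Lemma neg_setD1 v S : neg (S :\ v) = neg S :\ flip v.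
Proof. by apply/setP => u; rewrite !inE (can2_eq flipK flipK). Qed.

Lemma card_neg S : #|neg S| = #|S|.
Proof. by rewrite on_card_preimset //; exists flip => u _; rewrite flipK. Qed.

Lemma negS S V : (neg S \subset neg V) = (S \subset V).
Proof.
apply/subsetP/subsetP => sub v; last by rewrite !in_neg; apply: sub.
by move=> vS; have := sub (flip v); rewrite !in_neg flipK; apply.
Qed.

Lemma consistentP S : reflect {in S, forall v, flip v \notin S} (consistent S).
Proof. exact: forall_inP. Qed.

Lemma consistent_sub S S' : S \subset S' -> consistent S' -> consistent S.
Proof.
move=> /subsetP sub /consistentP cS; apply/consistentP => v /sub /cS.
by apply: contra => /sub.
Qed.

Lemma consistent_neg S : consistent (neg S) = consistent S.
Proof.
apply/consistentP/consistentP => cS v; last by rewrite !in_neg; apply: cS.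
by move=> vS; have := cS (flip v); rewrite !in_neg flipK; apply.
Qed.

Lemma consistent_setU1 v S :
  consistent S -> flip v \notin S -> consistent (v |: S).
Proof.
move=> /consistentP cS vS; apply/consistentP => u /setU1P[->|uS].
  by rewrite !inE negb_or flip_neq.
rewrite !inE negb_or cS // andbT; apply: contraNneq vS => <-.
by rewrite flipK.
Qed.

Lemma neg_consistent_neq S : consistent S -> S != set0 -> neg S != S.
Proof.
move=> /consistentP cS /set0Pn[v vS]; apply: contraTneq vS => eS.
by rewrite -eS in_neg; apply/negP => vS; have := cS _ vS; rewrite flipK -eS in_neg vS.
Qed.

Lemma consistent_card S : consistent S -> (#|S| <= #|T|)%N.
Proof.
move=> /consistentP cS; rewrite -(@card_in_imset _ _ fst) ?max_card //.
move=> [i b] [i' b'] /cS + + /= eii; rewrite -eii /flip /=.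
by case: b b' => [] [] // /negPf ->.
Qed.

(* The simplicial boundary mod 2, augmented by the empty simplex. *)
Definition bd c : chain := [ffun S : {set T * bool} => \sum_(v | v \notin S) c (v |: S)].

Definition act c : chain := [ffun S : {set T * bool} => c (neg S)].

Definition cone v c : chain := [ffun S : {set T * bool} => if v \in S then c (S :\ v) else 0].

(** The index [j] counts vertices, so these are chains of dimension j - 1 on the full subcomplex
    spanned by [V]. *)
Definition supported V j c :=
  forall S, c S != 0 -> [/\ S \subset V, consistent S & #|S| = j].

Lemma bdD c c' : bd (c + c') = bd c + bd c'.
Proof.
by apply/ffunP => S; rewrite !ffunE -big_split; apply: eq_bigr => v _; rewrite ffunE.
Qed.

Lemma bd0 : bd 0 = 0.
Proof. by apply/ffunP => S; rewrite !ffunE big1 // => v _; rewrite ffunE. Qed.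

Lemma bd_sum (I : Type) (r : seq I) (P : pred I) (F : I -> chain) :
  bd (\sum_(i <- r | P i) F i) = \sum_(i <- r | P i) bd (F i).
Proof. exact: (big_morph bd bdD bd0). Qed.

Lemma actD c c' : act (c + c') = act c + act c'.
Proof. by apply/ffunP => S; rewrite !ffunE. Qed.

Lemma act0 : act 0 = 0.
Proof. by apply/ffunP => S; rewrite !ffunE. Qed.

Lemma act_sum (I : Type) (r : seq I) (P : pred I) (F : I -> chain) :
  act (\sum_(i <- r | P i) F i) = \sum_(i <- r | P i) act (F i).
Proof. exact: (big_morph act actD act0). Qed.

Lemma actK : involutive act.
Proof. by move=> c; apply/ffunP => S; rewrite !ffunE negK. Qed.

Lemma bd_act c : bd (act c) = act (bd c).
Proof.
apply/ffunP => S; rewrite !ffunE (reindex_inj (inv_inj flipK)) /=.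
by apply: eq_big => v; rewrite ?in_neg // => _; rewrite ffunE neg_setU1 flipK.
Qed.

Lemma bd_bd c : bd (bd c) = 0.
Proof.
apply/ffunP => S; rewrite !ffunE.
under eq_bigr do rewrite ffunE.
rewrite pair_big_dep /=.
apply: (@sum_involution _ _ _ (fun p => (p.2, p.1))) => [|[u v] /=]; first exact: F2_addxx.
rewrite !inE !negb_or xpair_eqE [v == u]eq_sym setUCA.
by case: (u == v) (u \in S) (v \in S) => [] [] [].
Qed.

(** Pointwise form of the cone homotopy bd (cone v c) = c + cone v (bd c). *)
Lemma bd_cone v c S :
  bd (cone v c) S = if v \in S then bd c (S :\ v) + c S else c S.
Proof.
rewrite ffunE; case: ifP => vS; last first.
  rewrite (bigD1 v) ?vS //= ffunE setU11 setU1K ?vS // big1 ?addr0 //.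
  move=> u /andP[_ uv]; rewrite ffunE ifF //.
  by rewrite !inE vS eq_sym (negPf uv).
rewrite ffunE [X in _ = X + _](bigD1 v) /= ?setD11 // setD1K // addrAC F2_addxx add0r.
apply: eq_big => [u|u uS].
  by rewrite !inE; case: eqVneq => [->|_] /=; rewrite ?vS ?andbT.
rewrite ffunE !inE vS orbT; congr (c _); apply/setP => w; rewrite !inE.
case: (eqVneq w u) => [->|] //=; rewrite andbT.
by apply: contraNneq uS => ->.
Qed.

Lemma bd_cone_cycle v c : bd c = 0 -> bd (cone v c) = c.
Proof.
by move=> c0; apply/ffunP => S; rewrite bd_cone c0 ffunE add0r if_same.
Qed.

Lemma supportedD V j c c' :
  supported V j c -> supported V j c' -> supported V j (c + c').
Proof.
move=> sc sc' S; rewrite ffunE; have [c0|/sc //] := eqVneq (c S) 0.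
by rewrite c0 add0r; exact: sc'.
Qed.

Lemma supported0 V j : supported V j 0.
Proof. by move=> S; rewrite ffunE eqxx. Qed.

Lemma supported_sum V j (I : Type) (r : seq I) (P : pred I) (F : I -> chain) :
  (forall i, P i -> supported V j (F i)) -> supported V j (\sum_(i <- r | P i) F i).
Proof. by move=> sF; apply: big_ind => //; [exact: supported0|exact: supportedD]. Qed.

Lemma supportedW V V' j c : V \subset V' -> supported V j c -> supported V' j c.
Proof. by move=> sub sc S /sc[sS ? ?]; split=> //; exact: subset_trans sub. Qed.

Lemma supported_act V j c : supported V j c -> supported (neg V) j (act c).
Proof.
move=> sc S; rewrite ffunE => /sc[sS cS <-].
by rewrite -negS negK sS -consistent_neg cS card_neg.
Qed.

Lemma supported_bd V j c : supported V j.+1 c -> supported V j (bd c).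
Proof.
move=> sc S; rewrite ffunE => nz.
have /existsP[v /andP[vS /sc[sS cS]]] :
    [exists v, (v \notin S) && (c (v |: S) != 0)].
  apply: contraNT nz; rewrite negb_exists => /forallP nv.
  rewrite big1 // => v vS; apply/eqP.
  by have := nv v; rewrite vS /= negbK.
rewrite cardsU1 vS => -[<-]; split=> //.
  exact: subset_trans (subsetUr _ _) sS.
exact: consistent_sub (subsetUr _ _) cS.
Qed.

Lemma supported_cone V j v c : v \in V ->
  supported (V :\ flip v) j c -> supported V j.+1 (cone v c).
Proof.
move=> vV sc S; rewrite ffunE; case: ifP => [vS|]; last by rewrite eqxx.
move=> /sc[sS cS <-]; rewrite (cardsD1 v S) vS -(setD1K vS); split=> //.
  by rewrite subUset sub1set vV (subset_trans sS) ?subsetDl.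
apply: consistent_setU1 => //; apply/negP => /(subsetP sS).
by rewrite !inE eqxx.
Qed.

(** No nonempty consistent set is its own antipode, so [g] can keep one simplex from each antipodal
    pair. The index [j.+1] excludes the empty simplex. *)
Lemma act_fixed_split V j c : supported V j.+1 c -> act c = c ->
  exists2 g, supported V j.+1 g & c = g + act g.
Proof.
move=> sc cE.
pose lo S := (enum_rank S < enum_rank (neg S))%N.
exists [ffun S : {set T * bool} => if lo S then c S else 0].
  by move=> S; rewrite ffunE; case: ifP => [_|_ /eqP//]; exact: sc.
apply/ffunP => S; rewrite !ffunE /lo negK.
have -> : c (neg S) = c S by rewrite -[in RHS]cE ffunE.
have [->|/sc[_ cS cardS]] := eqVneq (c S) 0; first by rewrite !if_same addr0.
have : neg S != S.
  by apply: neg_consistent_neq => //; rewrite -card_gt0 cardS.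
by rewrite -(inj_eq enum_rank_inj) -(inj_eq val_inj) /=; case: ltngtP;
  rewrite ?addr0 ?add0r.
Qed.

(** In the first case the subcomplex is a cone. Otherwise it is a cross-polytope boundary, and the
    induction treats it as the suspension, with poles [v] and [flip v], of the one with a single
    axis fewer. *)
Lemma fill j V c : supported V j c -> bd c = 0 ->
    (exists2 v, v \in V & flip v \notin V) \/ (j < #|fst @: V|)%N ->
  exists2 w, supported V j.+1 w & bd w = c.
Proof.
have coneP V' j' v c' : v \in V' -> supported (V' :\ flip v) j' c' -> bd c' = 0 ->
    exists2 w, supported V' j'.+1 w & bd w = c'.
  move=> vV sc c0; exists (cone v c'); last exact: bd_cone_cycle.
  exact: supported_cone.
elim: j V c => [|j IH] V c sc c0 hV.
  have [v vV] : exists v, v \in V.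
    case: hV => [[v]|/card_gt0P[i /imsetP[v]]]; by exists v.
  apply: (coneP _ _ v) => // S /sc[_ cS cardS]; split=> //.
  by rewrite (cards0_eq cardS) sub0set.
have [[v vV nvV]|nV] := EM (exists2 v, v \in V & flip v \notin V).
  apply: (coneP _ _ v) => //.
  suff -> : V :\ flip v = V by [].
  by apply/setDidPl; rewrite disjoint_sym disjoints1.
case: hV => // hV.
have [i /imsetP[v vV _]] : exists i, i \in fst @: V.
  by apply/card_gt0P; apply: leq_ltn_trans hV.
pose b := flip v.
have bV : b \in V by apply: contra_notT nV => nb; exists v.
pose V1 := V :\ v :\ b.
(* [c1] is the link of the pole [b] in [c]: a cycle one dimension lower, on the remaining axes. *)
pose c1 : chain := [ffun S : {set T * bool} => if b \in S then 0 else c (b |: S)].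
have sc1 : supported V1 j c1.
  move=> S; rewrite ffunE; case: ifP => [_ /eqP//|/negbT bS /sc[sS cS]].
  rewrite cardsU1 bS => -[cardS]; split=> //.
    rewrite !subsetD1 bS andbT (subset_trans (subsetUr _ _) sS) /=.
    have /consistentP/(_ b) := cS; rewrite setU11 flipK => /(_ isT).
    by apply: contra => vS; rewrite inE vS orbT.
  exact: consistent_sub (subsetUr _ _) cS.
have bd1 : bd c1 = 0.
  apply/ffunP => S; rewrite !ffunE; case bS: (b \in S).
    by rewrite big1 // => u _; rewrite ffunE inE bS orbT.
  have /ffunP/(_ (b |: S)) := c0; rewrite !ffunE => E; rewrite -[RHS]E.
  rewrite (bigD1 b) ?bS //= ffunE setU11 add0r.
  apply: eq_big => u; first by rewrite !inE negb_or andbC.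
  move=> /andP[uS ub]; by rewrite ffunE !inE bS orbF eq_sym (negPf ub) setUCA.
have hV1 : (j < #|fst @: V1|)%N.
  rewrite -ltnS (leq_trans hV) // -[X in (_ <= X)%N]addn1 -(cards1 v.1) addnC.
  rewrite (leq_trans _ (leq_card_setU _ _)) // subset_leq_card //.
  apply/subsetP => _ /imsetP[u uV ->]; rewrite !inE.
  have [//|uv] := eqVneq u.1 v.1; rewrite imset_f // !inE uV andbT.
  by apply/andP; split; apply: contraNneq uv => ->.
have [w1 sw1 bw1] := IH V1 c1 sc1 bd1 (or_intror hV1).
(* Adding this boundary cancels every simplex containing [b], so [c'] can be coned off from [v]. *)
pose c' := c + bd (cone b w1).
have swb : supported V j.+2 (cone b w1).
  apply: supported_cone => //; rewrite flipK.
  by apply: supportedW sw1; exact: subsetDl.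
have sc' : supported V j.+1 c' by apply: supportedD => //; exact: supported_bd.
have [||w sw bw] := coneP V j.+1 v c' vV.
- move=> S nz; have [sS cS cardS] := sc' S nz; split=> //.
  rewrite subsetD1 sS /=; apply: contraNN nz => bS.
  rewrite ffunE bd_cone bS bw1 ffunE setD11 setD1K //.
  have [->|/sw1[sS1 _ _]] := eqVneq (w1 S) 0; first by rewrite addr0 F2_addxx.
  by have := subsetP sS1 b bS; rewrite !inE eqxx.
- by rewrite bdD bd_bd c0 addr0.
exists (w + cone b w1); first exact: supportedD.
by rewrite bdD bw /c' -addrA addF2 addr0.
Qed.

End Chains.

(** * Equivariant acyclic carriers *)


Section Carrier.
Variables (n : nat) (T : finType).
Notation signed := {set 'I_n * bool}.
Variable V : signed -> {set T * bool}.
Hypothesis V_mono : forall x y : signed, x \subset y -> V x \subset V y.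
Hypothesis V_neg : forall x : signed, V (neg x) = neg (V x).
Hypothesis V_fill : forall x : signed, consistent x -> x != set0 ->
  (exists2 v, v \in V x & flip v \notin V x) \/ (#|x| <= #|fst @: V x|)%N.
Implicit Types x y : signed.

(** Chains form a finite type, so a filling can be found by search; the default 0 arises when there
    is none. *)
Definition pick_fill (W : {set T * bool}) j (c : chain T) : chain T :=
  odflt 0 [pick w : chain T | `[< supported W j w >] && (bd w == c)].

(* Fills are chosen on one member of each antipodal pair {x, neg x} and
   transported to the other, which makes the resulting chain map equivariant. *)
Fixpoint carried j x : chain T :=
  if j is i.+1 then
    let z y := \sum_(u in y) carried i (y :\ u) in
    if (enum_rank x < enum_rank (neg x))%N then pick_fill (V x) j (z x)
    else act (pick_fill (V (neg x)) j (z (neg x)))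
  else [ffun S : {set T * bool} => if S == set0 then 1 else 0].

Lemma pick_fillP W j c : supported W j c -> bd c = 0 ->
    (exists2 v, v \in W & flip v \notin W) \/ (j < #|fst @: W|)%N ->
  supported W j.+1 (pick_fill W j.+1 c) /\ bd (pick_fill W j.+1 c) = c.
Proof.
move=> sc c0 /(fill sc c0)[w sw bw]; rewrite /pick_fill; case: pickP => /=.
  by move=> w' /andP[/asboolP sw' /eqP].
by move=> /(_ w); rewrite bw eqxx andbT => /asboolP.
Qed.

Lemma bd_carried0 x : bd (carried 0 x) = 0.
Proof.
apply/ffunP => S; rewrite !ffunE big1 // => v _; rewrite ffunE ifF //.
by apply/negbTE/set0Pn; exists v; rewrite setU11.
Qed.

(** The clauses make [carried] an equivariant chain map carried by [V]. By induction the images of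
    the facets sum to a cycle inside [V x], which [fill] bounds. *)
Lemma carriedP j x : consistent x -> #|x| = j ->
  [/\ supported (V x) j (carried j x),
      bd (carried j x) = \sum_(u in x) carried j.-1 (x :\ u) &
      carried j (neg x) = act (carried j x)].
Proof.
elim: j x => [|j IH] x cx cardx.
  rewrite (cards0_eq cardx); split.
  - move=> S; rewrite ffunE; case: ifP => [/eqP-> _|_ /eqP//].
    rewrite sub0set cards0; split=> //.
    by apply/consistentP => v; rewrite inE.
  - by rewrite big_set0 bd_carried0.
  - apply/ffunP => S; rewrite !ffunE; congr (if _ then _ else _).
    by rewrite -!cards_eq0 card_neg.
pose z y := \sum_(u in y) carried j (y :\ u).
have facet y u : consistent y -> #|y| = j.+1 -> u \in y ->
    consistent (y :\ u) /\ #|y :\ u| = j.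
  move=> cy cardy uy; split; first exact: consistent_sub (subsetDl _ _) cy.
  by have := cardsD1 u y; rewrite uy cardy => -[].
have z_neg y : consistent y -> #|y| = j.+1 -> z (neg y) = act (z y).
  move=> cy cardy; rewrite act_sum /z (reindex_inj (inv_inj (@flipK _))) /=.
  apply: eq_big => [u|u uy]; first by rewrite in_neg flipK.
  have uy' : u \in y by rewrite in_neg flipK in uy.
  have [cyu cardyu] := facet y u cy cardy uy'.
  by have [_ _ <-] := IH _ cyu cardyu; rewrite neg_setD1.
have fillP y : consistent y -> #|y| = j.+1 ->
    supported (V y) j.+1 (pick_fill (V y) j.+1 (z y)) /\
    bd (pick_fill (V y) j.+1 (z y)) = z y.
  move=> cy cardy; apply: pick_fillP.
  - apply: supported_sum => u uy.
    have [cyu cardyu] := facet y u cy cardy uy.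
    have [sy _ _] := IH _ cyu cardyu.
    by apply: supportedW sy; apply: V_mono; exact: subsetDl.
  - rewrite bd_sum.
    under eq_bigr => u uy.
      have [cyu cardyu] := facet y u cy cardy uy.
      have [_ -> _] := IH _ cyu cardyu; over.
    rewrite pair_big_dep /=.
    apply: (@sum_involution _ _ _ (fun p => (p.2, p.1))) => [|[u v] /=]; first exact: addF2.
    rewrite !inE xpair_eqE [v == u]eq_sym !setDDl [[set v] :|: _]setUC.
    by case: (u == v) (u \in y) (v \in y) => [] [] [].
  - rewrite -cardy; apply: V_fill => //.
    by rewrite -card_gt0 cardy.
have cnx : consistent (neg x) by rewrite consistent_neg.
have cardnx : #|neg x| = j.+1 by rewrite card_neg.
have nx : neg x != x by apply: neg_consistent_neq; rewrite // -card_gt0 cardx.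
have [s1 b1] := fillP _ cx cardx; have [s2 b2] := fillP _ cnx cardnx.
rewrite /= -/(z x) -/(z (neg x)) negK -/(z x).
move: nx; rewrite -(inj_eq enum_rank_inj) -(inj_eq val_inj) /=.
case: ltngtP => // _ _; split=> //; last by rewrite actK.
  by rewrite -[x in V x]negK V_neg; exact: supported_act.
by rewrite bd_act b2 z_neg // actK.
Qed.

(** * Hemisphere chains and the Borsuk-Ulam argument *)

(** These are the facets of the cross-polytope on the first [j] coordinates, whose boundary is a
    sphere of dimension j - 1; a sum equal to 1 means exactly one sign. *)
Definition full j x := [forall i, ((i, true) \in x) + ((i, false) \in x) == (i < j)]%N.

Lemma fullP j x : reflect
  (forall i, ((i, true) \in x) + ((i, false) \in x) = (i < j))%N (full j x).
Proof. by apply: (iffP forallP) => h i; apply/eqP; apply: h. Qed.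

Lemma full_consistent j x : full j x -> consistent x.
Proof.
move=> /fullP fx; apply/consistentP => -[i b]; have := fx i; rewrite /flip /=.
by case: b; case: (_ \in x); case: (_ \in x); case: (_ < _)%N.
Qed.

Lemma full_neg j x : full j (neg x) = full j x.
Proof. by apply: eq_forallb => i; rewrite !in_neg addnC. Qed.

Lemma full_flip j x u : full j x -> u \in x -> full j (flip u |: x :\ u).
Proof.
move=> fx ux; apply/fullP => i; have /consistentP/(_ _ ux) := full_consistent fx.
move/fullP/(_ i): fx; case: u ux => i' b ux; rewrite /flip !inE !xpair_eqE /=.
have [->|_] /= := eqVneq i i'; last by [].
by case: b ux => -> /= <- /negPf ->; rewrite ?orbT.
Qed.

Lemma full0 x : full 0 x = (x == set0).
Proof.
apply/fullP/eqP => [f0|->] //; last by move=> i; rewrite !inE.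
apply/setP => -[i b]; rewrite inE; have := f0 i.
by case: b; case: (_ \in x); case: (_ \in x).
Qed.

Lemma full_setU1 (o : 'I_n) y : (o, true) \notin y ->
  full o.+1 ((o, true) |: y) = full o y.
Proof.
move=> oy; apply: eq_forallb => i; rewrite !inE !xpair_eqE /= andbF andbT.
have [->|io] /= := eqVneq i o; first by rewrite (negPf oy) ltnSn ltnn.
by rewrite ltnS leq_eqVlt (inj_eq val_inj) (negPf io).
Qed.

Lemma card_full j x : (j <= n)%N -> full j x -> #|x| = j.
Proof.
elim: j x => [|j IH] x jn; first by rewrite full0 => /eqP ->; rewrite cards0.
wlog ox : x / (Ordinal jn, true) \in x => [hw fx|].
  have [/hw->//|ox] := boolP ((Ordinal jn, true) \in x).
  rewrite -card_neg; apply: hw; last by rewrite full_neg.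
  have /fullP/(_ (Ordinal jn)) := fx; rewrite (negPf ox) in_neg /= ltnSn.
  by case: (_ \in x).
rewrite -(setD1K ox) (full_setU1 (o := Ordinal jn)) ?setD11 // => /IH E.
by rewrite cardsU1 setD11 E // ltnW.
Qed.

(** Image under [carried] of the upper hemisphere of the [o]-dimensional sphere. *)
Definition hemi (o : 'I_n) := \sum_(x | full o.+1 x && ((o, true) \in x)) carried o.+1 x.

Lemma supported_hemi (o : 'I_n) : supported setT o.+1 (hemi o).
Proof.
apply: supported_sum => x /andP[fx _].
have [sx _ _] := carriedP (full_consistent fx) (card_full (ltn_ord o) fx).
exact: supportedW (subsetT _) sx.
Qed.

(** The boundary of a hemisphere is its equator: removing coordinate [o] gives the facets of the
    equator, and every other ridge is shared by two facets of the hemisphere. *)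
Lemma bd_hemi (o : 'I_n) : bd (hemi o) = \sum_(x | full o x) carried o x.
Proof.
rewrite bd_sum.
transitivity (\sum_(x | full o.+1 x && ((o, true) \in x))
    (carried o (x :\ (o, true)) +
     \sum_(u | (u \in x) && (u != (o, true))) carried o (x :\ u))).
  apply: eq_bigr => x /andP[fx ox].
  have [_ -> _] := carriedP (full_consistent fx) (card_full (ltn_ord o) fx).
  by rewrite (bigD1 (o, true)).
rewrite big_split /= [X in _ + X]pair_big_dep /= [X in _ + X](_ : _ = 0) ?addr0.
  rewrite (reindex_onto (fun y => (o, true) |: y) (fun x => x :\ (o, true))) /=; last first.
    by move=> x /andP[_ /setD1K].
  have E y : (((o, true) |: y) :\ (o, true) == y) = ((o, true) \notin y).
    apply/eqP/idP => [<-|/setU1K//]; by rewrite setD11.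
  apply: eq_big => [y|y /andP[_ /eqP->]//].
  rewrite E setU11 andbT; case: (boolP (_ \in y)) => oy /=.
    rewrite andbF; apply/esym/negP => /fullP/(_ o).
    by rewrite oy ltnn.
  by rewrite full_setU1 // andbT.
(* The involution crosses the ridge to the neighbouring facet by reversing the sign at [u]. *)
apply: (@sum_involution _ _ _
    (fun p => ((flip p.2 |: p.1 :\ p.2) : signed, flip p.2))) => [|[x u] /=]; first exact: addF2.
move=> /and3P[/andP[fx ox] ux uo].
have /consistentP/(_ _ ux) nux := full_consistent fx.
have E : (flip u |: x :\ u) :\ flip u = x :\ u.
  by rewrite setU1K // !inE negb_and nux orbT.
rewrite full_flip // E flipK setD1K // setU11; split=> //=; last first.
  by rewrite -pair_eqE /pair_eq /= (negPf (flip_neq u)) andbF.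
rewrite !inE [_ == u]eq_sym uo ox orbT /=.
by apply: contraNneq nux => ->.
Qed.

Lemma full_split (o : 'I_n) : \sum_(x | full o.+1 x) carried o.+1 x = hemi o + act (hemi o).
Proof.
rewrite (bigID (fun x : signed => (o, true) \in x)) /=; congr (_ + _).
rewrite act_sum (reindex_inj (inv_inj (@negK _))) /=.
apply: eq_big => x; rewrite full_neg in_neg /flip /=.
  have [/= /fullP/(_ o)|//] := boolP (full _ _); rewrite ltnSn.
  by case: (_ \in x); case: (_ \in x).
move=> /andP[fx _].
by have [] := carriedP (full_consistent fx) (card_full (ltn_ord o) fx).
Qed.

(* If #|T| < n, the top hemisphere chain vanishes; descending, each hemisphere
   chain is g + act g up to a boundary, which in dimension 0 contradicts that
   the map preserves the augmentation. *)
Lemma carrier_dim : (n <= #|T|)%N.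
Proof.
rewrite leqNgt; apply/negP => ltTn.
have descent k (o : 'I_n) : (o + k)%N = #|T| -> exists g g',
    [/\ supported setT o.+1 g, supported setT o.+2 g' & hemi o = g + act g + bd g'].
  elim: k o => [|k IH] o.
    rewrite addn0 => oT; exists 0, 0; rewrite act0 bd0 !addr0.
    split; [exact: supported0|exact: supported0|].
    apply/ffunP => S; rewrite [RHS]ffunE; apply/eqP/negPn/negP.
    (* A simplex here would have [#|T|] + 1 vertices, more than a consistent set can have. *)
    by move=> /supported_hemi[_ /consistent_card + cS]; rewrite cS oT ltnn.
  move=> okT; have o1n : (o.+1 < n)%N.
    by rewrite (leq_ltn_trans _ ltTn) // -okT addnS ltnS leq_addr.
  have [|g [g' [sg sg' E]]] := IH (Ordinal o1n); first by rewrite -okT addSnnS.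
  (* The left side is the boundary of the next hemisphere. The equality makes [hemi o + bd g]
     invariant under [act], so that it splits. *)
  have Eo : hemi o + act (hemi o) = bd g + act (bd g).
    rewrite -full_split -[o.+1]/(nat_of_ord (Ordinal o1n)) -bd_hemi E.
    by rewrite !bdD bd_act bd_bd addr0.
  have sb : supported setT o.+1 (hemi o + bd g).
    by apply: supportedD; [exact: supported_hemi|exact: supported_bd].
  have [|g2 sg2 E2] := act_fixed_split sb.
    rewrite actD; apply: (addrI (hemi o + bd g)); rewrite addF2.
    by rewrite addrACA Eo addF2.
  exists g2, g; split=> //.
  by rewrite -E2 -addrA addF2 addr0.
have n0 : (0 < n)%N by apply: leq_ltn_trans ltTn.
(* Compare coefficients at the empty simplex: 1 in the image of the empty sign vector, but 0 in
   [bd g + act (bd g)], since the empty simplex is its own antipode. *)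
have [g [g' [sg sg' E]]] := descent #|T| (Ordinal n0) (add0n _).
have := bd_hemi (Ordinal n0); rewrite E !bdD bd_bd addr0 bd_act /=.
rewrite (eq_bigl (pred1 set0)) => [|x]; last exact: full0.
rewrite big_pred1_eq => /ffunP/(_ set0); rewrite !ffunE eqxx.
rewrite (_ : neg set0 = set0) ?F2_addxx => [/eqP|]; last first.
  by apply/setP => v; rewrite !inE.
by rewrite eq_sym oner_eq0.
Qed.

End Carrier.

(** * Kneser graphs *)

(** Equality holds at s = k. Each step from s to s + 1 adds 2 on the left and C(s, k - 1) >= 2 on
    the right. *)
Lemma leq_double_bin k s : (1 < k)%N -> (k <= s)%N ->
  (2 * s <= (2 * k).-1 + 'C(s, k))%N.
Proof.
case: k => [|[|k]] // _ /subnKC <-; elim: (s - k.+2)%N => [|r IH].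
  by rewrite addn0 binn; lia.
have : (2 <= 'C(k.+2 + r, k.+1))%N.
  rewrite addSn binS.
  have : (0 < 'C(k.+1 + r, k.+1))%N by rewrite bin_gt0 leq_addr.
  have : (0 < 'C(k.+1 + r, k))%N by rewrite bin_gt0; lia.
  lia.
by rewrite addnS binS; lia.
Qed.

(** * Labels from a star-free colouring *)

Section KneserBound.
Variables (n k m : nat) (c : kneser n k -> nat).
Hypotheses (k_gt1 : (1 < k)%N) (c_star : star_free_coloring c).
Hypothesis c_le : forall A, (c A <= m)%N.
Implicit Types (x : {set 'I_n * bool}) (b : bool).

Definition side b x : {set 'I_n} := [set i | (i, b) \in x].

(** Colours up to [m] have halves from 0 to [m./2]. With 2k - 1 padding axes the count of
    [leq_double_bin] is tight at s = k. *)
Notation label := ('I_(2 * k).-1 + 'I_(m./2.+1))%type.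

(* The first summand pads the labels so that sign vectors with fewer than k
   entries of each sign, which see no colour, satisfy the count in
   [carrier_dim]. *)
Definition labels x : {set label * bool} :=
  [set w : label * bool | match w.1 with
           | inl _ => true
           | inr i => [exists A : kneser n k,
               (val A \subset side w.2 x) && ((c A)./2 == i :> nat)]
           end].

Definition half A : 'I_(m./2.+1) := inord (c A)./2.

Lemma halfE A : half A = (c A)./2 :> nat.
Proof. by rewrite inordK // ltnS half_leq. Qed.

Lemma side_neg b x : side b (neg x) = side (~~ b) x.
Proof. by apply/setP => i; rewrite !inE. Qed.

Lemma labels_mono x (y : {set 'I_n * bool}) : x \subset y -> labels x \subset labels y.
Proof.
move=> /subsetP sub; apply/subsetP => -[[i|i] b]; rewrite !inE //=.
move=> /existsP[A /andP[sA cA]]; apply/existsP; exists A; rewrite cA andbT.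
by apply: subset_trans sA _; apply/subsetP => j; rewrite !inE; apply: sub.
Qed.

Lemma labels_neg x : labels (neg x) = neg (labels x).
Proof.
apply/setP => -[[i|i] b]; rewrite !inE //=.
by apply: eq_existsb => A; rewrite side_neg.
Qed.

Lemma side_disjoint b x : consistent x -> [disjoint side b x & side (~~ b) x].
Proof.
move=> /consistentP cx; rewrite disjoint_subset; apply/subsetP => i.
by rewrite !inE => /cx.
Qed.

Lemma card_sides x : #|x| = (#|side true x| + #|side false x|)%N.
Proof.
have E b : #|side b x| = #|[set u in x | u.2 == b]|.
  rewrite -(card_imset _ (_ : injective (fun i : 'I_n => (i, b)))) => [|i j []//].
  apply: eq_card => -[i b']; rewrite !inE /=; apply/imsetP/andP.
    by move=> [j]; rewrite inE => jx [-> ->].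
  by move=> [ix /eqP <-]; exists i; rewrite ?inE.
rewrite !E -(cardsID [set u | u.2]); congr (_ + _)%N; apply: eq_card => u.
  by rewrite !inE eqb_id.
by rewrite !inE andbC; case: u.2; rewrite ?andbF ?andbT.
Qed.

Lemma kneser_adj_sides b x (A B : kneser n k) : consistent x ->
  val A \subset side b x -> val B \subset side (~~ b) x -> adj A B.
Proof.
move=> cx sA sB; have dAB : [disjoint val A & val B].
  by rewrite (disjointWl sA) // (disjointWr sB) // side_disjoint.
rewrite /= /kneser_adj dAB andbT; apply: contraTneq dAB => ->.
by rewrite -setI_eq0 setIid -cards_eq0 (eqP (valP B)); lia.
Qed.

(* If a colour class {2i, 2i+1} contained two k-subsets of one side and one of
   the other, these three would form a path violating star-freeness. *)
Lemma half_inj_side b x : consistent x ->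
    (forall w, w \in labels x -> flip w \in labels x) ->
  {in [set A : kneser n k | val A \subset side b x] &, injective half}.
Proof.
move=> cx sym A A'; rewrite !inE => sA sA' eqAA'.
apply/eqP/negPn/negP => neAA'.
have : (inr (half A), b) \in labels x.
  by rewrite inE /=; apply/existsP; exists A; rewrite sA halfE eqxx.
move=> /sym; rewrite inE => /existsP[B /andP[sB]]; rewrite halfE => /eqP cB.
have cA' : (c A')./2 = (c A)./2 by rewrite -!halfE eqAA'.
have [_ /(_ A B A')] := c_star.
rewrite /path3 neAA' (kneser_adj_sides cx sA sB) adj_sym (kneser_adj_sides cx sA' sB).
(* All three colours lie in the pair that starts at this even number. *)
apply=> //; exists (c A)./2.*2 => v; rewrite !inE => /or3P[] /eqP->; lia.
Qed.

Lemma card_kneser_sub (S : {set 'I_n}) :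
  #|[set A : kneser n k | val A \subset S]| = 'C(#|S|, k).
Proof.
rewrite -cards_draws -(card_imset _ val_inj); apply: eq_card => B.
rewrite !inE; apply/imsetP/andP => [[A + ->]|[sB cB]].
  by rewrite inE => ->; rewrite (valP A).
by exists (Sub B cB); rewrite ?inE.
Qed.

Lemma labels_fill x : consistent x -> x != set0 ->
  (exists2 w, w \in labels x & flip w \notin labels x) \/
  (#|x| <= #|fst @: labels x|)%N.
Proof.
move=> cx _; have [|nV] := EM (exists2 w, w \in labels x & flip w \notin labels x).
  by left.
right; have sym w : w \in labels x -> flip w \in labels x.
  by move=> wV; apply: contra_notT nV => nw; exists w.
(* The larger side alone sees enough classes, as [half] is injective on its k-subsets. *)
have [b xb] : exists b, (#|x| <= 2 * #|side b x|)%N.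
  rewrite card_sides; case: (leqP #|side true x| #|side false x|) => h.
    by exists false; lia.
  by exists true; lia.
pose D := half @: [set A : kneser n k | val A \subset side b x].
have cardD : #|D| = 'C(#|side b x|, k).
  by rewrite card_in_imset ?card_kneser_sub //; exact: half_inj_side.
have lower : ((2 * k).-1 + #|D| <= #|fst @: labels x|)%N.
  have -> : ((2 * k).-1 + #|D| = #|(inl @: setT : {set label}) :|: inr @: D|)%N.
    rewrite cardsU (_ : _ :&: _ = set0) ?cards0 ?subn0; last first.
      apply/setP => w; rewrite !inE; apply/negP => /andP[/imsetP[i _ ->]].
      by case/imsetP.
    rewrite [#|inl @: _|]card_imset => [|? ? []//].
    by rewrite [#|inr @: D|]card_imset ?cardsT ?card_ord // => ? ? [].
  apply: subset_leq_card; rewrite subUset; apply/andP; split; apply/subsetP.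
    by move=> _ /imsetP[i _ ->]; apply/imsetP; exists (inl i, b); rewrite ?inE.
  move=> _ /imsetP[_ /imsetP[A + ->] ->]; rewrite inE => sA.
  apply/imsetP; exists (inr (half A), b) => //; rewrite inE /=.
  by apply/existsP; exists A; rewrite sA halfE eqxx.
apply: leq_trans lower; rewrite cardD; have [kS|Sk] := leqP k #|side b x|.
  exact: leq_trans xb (leq_double_bin k_gt1 kS).
(* With both sides smaller than k, the padding axes suffice. *)
by rewrite (leq_trans xb) //; lia.
Qed.

Lemma star_free_kneser_bound : (2 * (n - 2 * k) <= m)%N.
Proof.
have := carrier_dim labels_mono labels_neg labels_fill.
rewrite card_sum !card_ord; lia.
Qed.

End KneserBound.

(** * Upper bound on the chromatic number, and conclusion *)

Lemma kneser_colorable n k : (0 < k)%N -> (2 * k <= n)%N ->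
  colorable (kneser n k) (n - 2 * k + 2).
Proof.
move=> k0 nk; have n0 : (0 < n)%N by lia.
have /choice[first firstP] (A : kneser n k) : exists a : 'I_n,
    a \in val A /\ forall i, i \in val A -> (a <= i)%N.
  have /card_gt0P[a aA] : (0 < #|val A|)%N by rewrite (eqP (valP A)).
  by case: (arg_minnP (fun i : 'I_n => i : nat) aA) => i iA imin; exists i.
(* The usual colouring by least element, truncated: counting from 0, sets with least element at
   least n - 2k + 1 lie in 2k - 1 points, so no two are disjoint. *)
exists (fun A => (minn (first A) (n - 2 * k + 1)).+1); split; last by move=> A; lia.
move=> A B /andP[_ dAB]; have [fA minA] := firstP A; have [fB minB] := firstP B.
have neq : first A <> first B :> nat.
  move=> /val_inj eqAB; move/pred0P: dAB => /(_ (first A)) /=.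
  by rewrite fA eqAB fB.
move=> eqAB; have tail : (val A :|: val B) \subset [set i : 'I_n | n - 2 * k + 1 <= i]%N.
  by apply/subsetP => i /setUP[/minA|/minB]; rewrite inE; lia.
have := subset_leq_card tail; rewrite cardsU (disjoint_setI0 dAB) cards0 subn0.
rewrite (eqP (valP A)) (eqP (valP B)).
have -> : #|[set i : 'I_n | n - 2 * k + 1 <= i]%N| = (2 * k - 1)%N.
  rewrite cardsE -sum1_card -(big_geq_mkord (n - 2 * k + 1) n xpredT (fun=> 1%N)).
  by rewrite sum_nat_const_nat; lia.
lia.
Qed.

Local Close Scope ring_scope.

Theorem theorem2 (n k : nat) (n_gt0 : 0 < n) (k_gt0 : 0 < k)
    (n_ge2k : 2 * k <= n) (k2_ge4 : 4 <= 2 * k) :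
  (Num.max (2 * (chromatic_number (kneser n k))%:Z - 10)
           (chromatic_number (kneser n k))%:Z
     <= (star_free_chromatic_number (kneser n k))%:Z)%R.
Proof.
have chiP : chromatic_number (kneser n k) <= n - 2 * k + 2.
  rewrite /chromatic_number; case: ex_minnP => t _; apply; apply/asboolP.
  exact: kneser_colorable.
rewrite /star_free_chromatic_number; case: ex_minnP => m /asboolP[_ [c [cs c_le]]] _.
(* With [chiP] this gives m >= 2 chi - 4, which covers 2 chi - 10. *)
have m_ge : 2 * (n - 2 * k) <= m.
  apply: (@star_free_kneser_bound n k m c) => //; first by lia.
  by move=> A; case/andP: (c_le A).
have : chromatic_number (kneser n k) <= m.
  rewrite /chromatic_number; case: ex_minnP => t _; apply; apply/asboolP.
  by exists c; split=> //; case: cs.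
by rewrite ge_max; lia.
Qed.
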